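(* A connected graph $G$ is direct-topfull if and only if for any two vertices $u,v\in V(G)$ there exists a $u,v$-path $P$ in $G$ such that every edge of $P$ belongs to a member of some vertex-disjoint cycle/edge cover of $G$ (the cover may depend on the edge).
   Context: Graphs are finite, simple and undirected; $d_G$ denotes shortest-path distance. For an integer $\ell\ge0$, an $\ell$-track on $G$ is a surjective function $f:\{0,\dots,\ell\}\to V(G)$ with $f(i)f(i+1)\in E(G)$ for all $0\le i<\ell$. For a family $F=\{f_1,\dots,f_p\}$ of functions $\{0,\dots,\ell\}\to V(G)$ with $p\ge 2$, $m_G(F)=\min_{i\ne j}\min_t d_G(f_i(t),f_j(t))$. An $\ell$-tour is a family of $\ell$-tracks. The direct $1$-capacity $\mathrm{cap}^\times_1(G)$ (for non-trivial $G$) is the maximum $c$ such that there is an $\ell$-tour $F=\{f_1,\dots,f_c\}$ on $G$ (for some $\ell$) with $m_G(F)=1$. A connected graph on $n$ vertices is direct-topfull if $\mathrm{cap}^\times_1(G)=n$. A vertex-disjoint cycle/edge cover of $G$ is a set $S$ of subgraphs of $G$, each a cycle or isomorphic to $K_2$, such that every vertex of $G$ lies in some member of $S$ and distinct members of $S$ share no vertex. *)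

(* Defs.v *)
From mathcomp Require Import all_boot.

Set Implicit Arguments.
Unset Strict Implicit.
Unset Printing Implicit Defensive.

Record sgraph := SGraph {
  svertex :> finType;
  adj : rel svertex;
  adj_sym : symmetric adj;
  adj_irrefl : irreflexive adj }.

Arguments adj {s} _ _.

Section Graphs.
Variable G : sgraph.

Definition connected_graph : Prop := forall x y : G, connect adj x y.

Definition is_upath (u v : G) (p : seq G) : bool :=
  [&& path adj u p, last u p == v & uniq (u :: p)].

Definition path_edges (u : G) (p : seq G) : seq {set G} :=
  pairmap (fun x y => [set x; y]) u p.

(* The value #|G|, which exceeds every finite distance, plays the role of
   infinity for vertices in different components. *)
Definition dist (x y : G) : nat :=
  \big[minn/#|G|]_(k < #|G| | [exists p : k.-tuple G, is_upath x y p]) k.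

Definition is_track (l : nat) (f : {ffun 'I_l.+1 -> G}) : Prop :=
  (forall v : G, exists i, f i = v) /\
  (forall i j : 'I_l.+1, j = i.+1 :> nat -> adj (f i) (f j)).

(* Meaningful for p >= 2 only; the default #|G| is never below a distance. *)
Definition fam_dist (l p : nat) (F : 'I_p -> {ffun 'I_l.+1 -> G}) : nat :=
  \big[minn/#|G|]_(i < p) \big[minn/#|G|]_(j < p | j != i)
    \big[minn/#|G|]_(t < l.+1) dist (F i t) (F j t).

Definition has_direct_tour1 (c : nat) : Prop :=
  2 <= c /\ exists (l : nat) (F : 'I_c -> {ffun 'I_l.+1 -> G}),
    (forall i, is_track (F i)) /\ fam_dist F = 1.

(* [is_direct_cap1 c]: the direct 1-capacity of G exists and equals c. *)
Definition is_direct_cap1 (c : nat) : Prop :=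
  has_direct_tour1 c /\ forall c', has_direct_tour1 c' -> c' <= c.

Definition direct_topfull : Prop := connected_graph /\ is_direct_cap1 #|G|.

(* A subgraph is given by its vertex set and its edge set. *)
Definition subgraph : finType := ({set G} * {set {set G}})%type.

Definition is_cycle_sub (H : subgraph) : Prop :=
  exists c : seq G,
    [/\ 3 <= size c, ucycle adj c, H.1 = [set x in c]
      & H.2 = [set [set x; next c x] | x in c]].

Definition is_K2_sub (H : subgraph) : Prop :=
  exists x y : G, [/\ adj x y, H.1 = [set x; y] & H.2 = [set [set x; y]]].

Definition is_cycle_edge_cover (S : {set subgraph}) : Prop :=
  [/\ forall H, H \in S -> is_cycle_sub H \/ is_K2_sub H,
      forall v : G, exists2 H : subgraph, H \in S & v \in H.1
    & forall H K : subgraph, H \in S -> K \in S -> H != K ->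
        [disjoint H.1 & K.1]].

Definition covered_edge (E : {set G}) : Prop :=
  exists2 S : {set subgraph}, is_cycle_edge_cover S
    & exists2 H : subgraph, H \in S & E \in H.2.

End Graphs.

(* Main.v *)
Require Import Defs.
From mathcomp Require Import all_boot.
From mathcomp Require Import perm.

Set Implicit Arguments.
Unset Strict Implicit.
Unset Printing Implicit Defensive.

(** When #|G| tracks never meet, each time step moves all of V(G) by a
    permutation sending every vertex to a neighbour, and the cycles of such a
    permutation form a vertex-disjoint cycle/edge cover; conversely, orienting
    the members of a cover gives such a permutation.  Hence the edges lying in
    some cover are the pairs {x, s x} with s of this kind, and both sides of
    the equivalence say that these permutations connect V(G): in one direction
    a track runs from u to v through them, in the other one concatenates
    permutations until every starting vertex has visited every vertex. *)

(** * Minima and distances *)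

Lemma leq_bigminn (I : finType) (P : pred I) (f : I -> nat) d m :
  m <= d -> (forall i, P i -> m <= f i) ->
  m <= \big[minn/d]_(i | P i) f i.
Proof.
by move=> md mf; elim/big_ind: _ => // a b; rewrite leq_min => -> ->.
Qed.

Lemma bigminn_leq (I : finType) (P : pred I) (f : I -> nat) d j :
  P j -> \big[minn/d]_(i | P i) f i <= f j.
Proof.
move=> Pj; have: j \in index_enum I by rewrite mem_index_enum.
elim: (index_enum I) => // i r IHr; rewrite in_cons big_cons.
case/predU1P=> [<-|/IHr le_j]; first by rewrite Pj geq_minl.
by case: ifP => // _; apply: leq_trans (geq_minr _ _) le_j.
Qed.
Arguments bigminn_leq {I P} f {d} j.

Section Topfull.
Variable G : sgraph.
Implicit Types (x y u v : G) (s : {perm G}) (w : seq {perm G}).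

Lemma dist_refl x : dist x x = 0.
Proof.
have G_gt0 : 0 < #|G| by apply/card_gt0P; exists x.
apply/eqP; rewrite -leqn0.
apply: (bigminn_leq (fun k : 'I_#|G| => k : nat) (Ordinal G_gt0)).
by apply/existsP; exists [tuple]; rewrite /is_upath /= eqxx.
Qed.

Lemma dist_gt0 x y : x != y -> 0 < dist x y.
Proof.
move=> neq_xy; apply: leq_bigminn => [|[[|k] ltk] //=].
  by apply/card_gt0P; exists x.
by case/existsP=> p; rewrite tuple0 /is_upath /= (negPf neq_xy).
Qed.

Lemma dist_adj x y : 1 < #|G| -> adj x y -> dist x y <= 1.
Proof.
move=> G_gt1 adj_xy.
(* The minimum ranges over lengths below [#|G|], so [G_gt1] is what makes length 1 available. *)
apply: (bigminn_leq (fun k : 'I_#|G| => k : nat) (Ordinal G_gt1)).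
apply/existsP; exists [tuple y]; rewrite /is_upath /= adj_xy eqxx inE !andbT /=.
by apply: contraTneq adj_xy => ->; rewrite adj_irrefl.
Qed.

Lemma fam_dist_leq l p (F : 'I_p -> {ffun 'I_l.+1 -> G}) i j t :
  j != i -> fam_dist F <= dist (F i t) (F j t).
Proof.
pose g i j := \big[minn/#|G|]_(t < l.+1) dist (F i t) (F j t).
move=> neq_ji; apply: (@leq_trans (g i j)); last first.
  exact: (bigminn_leq (fun t => dist (F i t) (F j t)) t).
apply: leq_trans (bigminn_leq (g i) j neq_ji).
exact: (bigminn_leq (fun i => \big[minn/#|G|]_(j < p | j != i) g i j) i).
Qed.

(** Two tracks at the same vertex at time [t] would bring the minimum down to 0. *)
Lemma fam_dist_inj l p (F : 'I_p -> {ffun 'I_l.+1 -> G}) t :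
  0 < fam_dist F -> injective (F^~ t).
Proof.
move=> F_gt0 i j /= eqF; apply/eqP; apply: contraTT F_gt0 => neq_ij.
rewrite -leqNgt; apply: leq_trans (fam_dist_leq F t _) _.
  by rewrite eq_sym; exact: neq_ij.
by rewrite eqF dist_refl.
Qed.

(** * Permutations that move every vertex along an edge *)

Definition shift s := [forall x, adj x (s x)].

Definition shift_rel := [rel x y : G | [exists s, shift s && (s x == y)]].

Lemma shift_relP x y :
  reflect (exists2 s, shift s & s x = y) (shift_rel x y).
Proof.
apply: (iffP existsP) => [[s /andP[shs /eqP sx]]|[s shs sx]]; exists s => //.
by rewrite shs sx eqxx.
Qed.

Lemma shift_rel_sym : symmetric shift_rel.
Proof.
suff sub x y : shift_rel x y -> shift_rel y x.
  by move=> x y; apply/idP/idP => /sub.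
case/shift_relP=> s /forallP shs <-; apply/shift_relP; exists (s^-1)%g.
  by apply/forallP=> z; rewrite adj_sym -{2}[z](permKV s).
by rewrite permK.
Qed.

Lemma sub_shift_adj : subrel shift_rel adj.
Proof. by move=> x y /shift_relP[s /forallP shs <-]. Qed.

Lemma shift_connect_sym : connect_sym shift_rel.
Proof. exact: sym_connect_sym shift_rel_sym. Qed.

(** The [#|G|] tracks occupy distinct vertices at time [t], hence all of them. So each vertex [v]
    carries exactly one track [h v], and sending [v] to the next position of that track is
    injective, as tracks are still apart at [t']. *)
Lemma shift_rel_tour l (F : 'I_#|G| -> {ffun 'I_l.+1 -> G}) i
    (t t' : 'I_l.+1) :
  (forall i, is_track (F i)) -> 0 < fam_dist F -> t' = t.+1 :> nat ->
  shift_rel (F i t) (F i t').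
Proof.
move=> Ftrack F_gt0 tt'; have Finj := @fam_dist_inj _ _ F _ F_gt0.
have [h hK Kh] := inj_card_bij (@Finj t) (eq_leq (esym (card_ord _))).
have s_inj : injective (fun v => F (h v) t').
  by move=> v w /Finj; apply: can_inj Kh _ _.
apply/shift_relP; exists (perm s_inj); last by rewrite permE hK.
apply/forallP=> v; rewrite permE -{1}[v]Kh.
by have [_] := Ftrack (h v); apply.
Qed.

(** A single track suffices, since it visits both [u] and [v]; symmetry of [shift_rel] allows going
    back from [u] to its start. *)
Lemma tour_shift_connect l (F : 'I_#|G| -> {ffun 'I_l.+1 -> G}) u v :
  (forall i, is_track (F i)) -> 0 < fam_dist F -> connect shift_rel u v.
Proof.
move=> Ftrack F_gt0.
have i : 'I_#|G| by apply: enum_rank u.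
have from0 (n : nat) (ltn : n < l.+1) :
    connect shift_rel (F i ord0) (F i (Ordinal ltn)).
  elim: n ltn => [|n IHn] ltn.
    by rewrite (_ : Ordinal ltn = ord0) //; apply: val_inj.
  apply: connect_trans (IHn (ltnW ltn)) (connect1 _).
  exact: shift_rel_tour.
have [Fsurj _] := Ftrack i.
have [[t ltt] <-] := Fsurj u; have [[t' ltt'] <-] := Fsurj v.
by apply: connect_trans (from0 _ ltt'); rewrite shift_connect_sym.
Qed.

(** * From a permutation to a cover *)

Definition orbit_subgraph s x : subgraph G :=
  ([set y in orbit s x], [set [set y; s y] | y in orbit s x]).

Lemma next_orbit s x y : y \in orbit s x -> next (orbit s x) y = s y.
Proof.
by move=> yx; have /eqP := next_cycle (cycle_orbit (@perm_inj _ s) x) yx.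
Qed.

(** An orbit of size 1 would be a loop, one of size 2 gives a $K_2$ whose edge arises twice, and a
    longer one gives a cycle. *)
Lemma orbit_subgraphP s x : shift s ->
  is_cycle_sub (orbit_subgraph s x) \/ is_K2_sub (orbit_subgraph s x).
Proof.
move=> /forallP shs; have cyc := cycle_orbit (@perm_inj _ s) x.
have adj_cyc : cycle adj (orbit s x).
  by apply: sub_cycle cyc => y z /eqP <-; apply: shs.
have [] := leqP 3 (size (orbit s x)) => sz.
  left; exists (orbit s x); split=> //.
    by rewrite /ucycle adj_cyc orbit_uniq.
  by apply: eq_in_imset => y yx /=; rewrite next_orbit.
right; exists x, (s x).
have orbE : orbit s x = [:: x; s x].
  move: sz adj_cyc; rewrite /orbit size_traject.
  have := order_gt0 s x; case: (order s x) => [|[|[|]]] //= _ _.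
  by rewrite adj_irrefl.
have ssx : s (s x) = x.
  by move: cyc; rewrite orbE /= andbT => /andP[_ /eqP].
split=> //; first by apply/setP=> y; rewrite /= orbE !inE.
rewrite /= orbE; apply/setP=> E; rewrite inE; apply/imsetP/eqP.
  by case=> y; rewrite !inE => /orP[] /eqP -> ->; rewrite ?ssx // setUC.
by move->; exists x => //; rewrite mem_head.
Qed.

Lemma shift_cover s : shift s ->
  is_cycle_edge_cover [set orbit_subgraph s x | x : G].
Proof.
move=> shs; split.
- by move=> _ /imsetP[x _ ->]; apply: orbit_subgraphP.
- move=> v; exists (orbit_subgraph s v); first exact: imset_f.
  by rewrite inE -fconnect_orbit.
- move=> _ _ /imsetP[x _ ->] /imsetP[y _ ->]; apply: contraR.
  (* Orbits sharing a vertex [z] coincide as sets, and both components of [orbit_subgraph] depend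
     only on that set. *)
  case/pred0Pn=> z /=; rewrite !inE -!fconnect_orbit => /andP[xz yz].
  have xy : fconnect s x y.
    by rewrite (connect_trans xz) // fconnect_sym //; apply: perm_inj.
  have eq_orb : orbit s x =i orbit s y.
    move=> v; rewrite -!fconnect_orbit.
    exact: (same_connect (fconnect_sym (@perm_inj _ s))).
  apply/eqP; congr (_, _); first by apply/setP=> v; rewrite !inE eq_orb.
  by apply/setP=> E; apply/imsetP/imsetP=> -[v vo ->]; exists v;
    rewrite ?eq_orb // -eq_orb.
Qed.

Lemma shift_rel_covered x y : shift_rel x y -> covered_edge [set x; y].
Proof.
case/shift_relP=> s shs <-.
exists [set orbit_subgraph s x | x : G]; first exact: shift_cover.
exists (orbit_subgraph s x); first exact: imset_f.
by apply/imsetP; exists x; rewrite // -fconnect_orbit.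
Qed.

(** * From a cover to a permutation *)

Lemma eq_set2 (T : finType) (a b c d : T) :
  a != b -> [set a; b] = [set c; d] -> (a = c /\ b = d) \/ (a = d /\ b = c).
Proof.
move=> neq_ab eqs.
have: a \in [set c; d] by rewrite -eqs set21.
have: b \in [set c; d] by rewrite -eqs set22.
by rewrite !inE => /orP[] /eqP eqb /orP[] /eqP eqa; auto;
  move: neq_ab; rewrite eqa eqb eqxx.
Qed.

(** An orientation of a member: a $K_2$ is treated as a closed walk of length 2, so that [next]
    applies to cycles and edges alike. *)
Definition spans (c : seq G) (H : subgraph G) :=
  [/\ uniq c, cycle adj c & H.1 = [set x in c]].

Lemma member_spanned H :
  is_cycle_sub H \/ is_K2_sub H -> exists c, spans c H.
Proof.
case=> [[c [_ /andP[cyc Uc] H1 _]]|[x [y [axy H1 _]]]]; first by exists c.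
exists [:: x; y]; split; last by apply/setP=> z; rewrite H1 !inE.
  rewrite /= inE andbT.
  by apply: contraTneq axy => ->; rewrite adj_irrefl.
by rewrite /= axy adj_sym axy.
Qed.

(** If the cyclic order traverses the edge from [y] to [x], reversing it gives the other
    direction. *)
Lemma member_spanned_through H x y :
  is_cycle_sub H \/ is_K2_sub H -> x != y -> [set x; y] \in H.2 ->
  exists2 c, spans c H & next c x = y.
Proof.
move=> memH neq_xy; case: memH.
  case=> c [_ /andP[cyc Uc] H1 ->] /imsetP[z zc /(eq_set2 neq_xy)].
  case=> [[-> ->]|[-> ->]]; first by exists c.
  exists (rev c); last by rewrite next_rev // prev_next.
  split; first by rewrite rev_uniq.
    by rewrite rev_cycle; under eq_cycle => a b do rewrite adj_sym.
  by rewrite H1; apply/setP=> a; rewrite !inE mem_rev.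
case=> a [b [aab H1 ->]]; rewrite inE => /eqP eqs.
have axy : adj x y.
  case: (eq_set2 neq_xy eqs) => [[-> ->] //|[-> ->]].
  by rewrite adj_sym.
exists [:: x; y]; last by rewrite /= eqxx.
split; first by rewrite /= inE neq_xy.
  by rewrite /= axy adj_sym axy.
by rewrite H1 -eqs; apply/setP=> z; rewrite !inE.
Qed.

(** Orient each member of the cover, taking for [H] an orientation that leads from [x] to [y]. As
    the members partition the vertices, their successor maps glue to a permutation. *)
Lemma covered_shift_rel x y :
  adj x y -> covered_edge [set x; y] -> shift_rel x y.
Proof.
move=> axy [S [Smem Scov Sdis] [H HS xyH]].
have neq_xy : x != y by apply: contraTneq axy => ->; rewrite adj_irrefl.
have [c0 c0H c0x] := member_spanned_through (Smem H HS) neq_xy xyH.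
have /fin_all_exists[c cP] (K : subgraph G) :
    exists c, K \in S -> spans c K /\ (K = H -> next c x = y).
  have [->|neqKH] := eqVneq K H; first by exists c0.
  have [KS|] := boolP (K \in S); last by exists [::].
  have [c cK] := member_spanned (Smem K KS).
  by exists c => _; split=> // eqKH; rewrite eqKH eqxx in neqKH.
have /fin_all_exists[K KP] v : exists K : subgraph G, K \in S /\ v \in K.1.
  by have [K] := Scov v; exists K.
have S_eq v (L M : subgraph G) :
    L \in S -> M \in S -> v \in L.1 -> v \in M.1 -> L = M.
  move=> LS MS vL vM; apply/eqP; apply: contraTT vM => /(Sdis _ _ LS MS).
  by move/disjointFr=> ->.
have cK v z : (z \in c (K v)) = (z \in (K v).1).
  by have [/cP[[_ _ ->] _] _] := KP v; rewrite inE.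
have s_inj : injective (fun v => next (c (K v)) v).
  move=> v w eq_next.
  have [KvS vK] := KP v; have [KwS wK] := KP w.
  have eqK : K v = K w.
    apply: (S_eq (next (c (K v)) v)) => //; first by rewrite -cK mem_next cK.
    by rewrite eq_next -cK mem_next cK.
  have [[Uc _ _] _] := cP _ KwS.
  by move: eq_next; rewrite eqK; apply: can_inj (prev_next Uc) _ _.
apply/shift_relP; exists (perm s_inj).
  apply/forallP=> v; rewrite permE.
  have [KS vK] := KP v; have [[_ cyc _] _] := cP _ KS.
  by apply: next_cycle cyc _; rewrite cK.
rewrite permE; have [KS xK] := KP x.
have [_ ->] := cP _ KS => //; apply: (S_eq x) => //.
(* [next] fixes everything outside the sequence, so [next c0 x = y] with [x != y] forces [x] to lie
   in [c0]. *)
have [_ _ ->] := c0H; rewrite inE; move: c0x; rewrite next_nth.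
by case: ifP => // _ /eqP; rewrite (negPf neq_xy).
Qed.

(** * From permutations to a tour *)

Definition walk_end x w := foldl (fun y s => s y) x w.

Lemma walk_end_inj w : injective (walk_end^~ w).
Proof. by elim: w => //= s w IHw x y /IHw /perm_inj. Qed.

Lemma connect_walk x y :
  connect shift_rel x y -> exists2 w, all shift w & walk_end x w = y.
Proof.
case/connectP=> p; elim: p x => [|z p IHp] x /=; first by exists [::].
case/andP=> /shift_relP[s shs sx] /IHp /[apply] -[w shw xw].
by exists (s :: w); rewrite /= ?shs ?sx.
Qed.

(** Pairs are served one at a time: an extension of [w] at its end leaves earlier positions
    unchanged and can lead the current end of the walk from [x] to [y]. *)
Lemma walk_visiting (L : seq (G * G)) :
  (forall x y, connect shift_rel x y) ->
  exists2 w, all shift w & {in L, forall a,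
    exists2 t, t <= size w & walk_end a.1 (take t w) = a.2}.
Proof.
move=> conn; elim: L => [|[x y] L [w shw wP]]; first by exists [::].
have [w' shw' w'y] := connect_walk (conn (walk_end x w) y).
exists (w ++ w') => [|a]; first by rewrite all_cat shw.
rewrite in_cons => /predU1P[->|/wP[t t_le <-]].
  by exists (size (w ++ w')); rewrite // take_size /walk_end foldl_cat.
exists t; first by rewrite size_cat (leq_trans t_le) ?leq_addr.
by rewrite takel_cat.
Qed.

Lemma shift_connect_tour : 1 < #|G| -> connected_graph G ->
  (forall x y, connect shift_rel x y) -> has_direct_tour1 G #|G|.
Proof.
move=> G_gt1 Gconn /(walk_visiting (enum {: G * G}))[w /allP shw wP].
split=> //; pose F (i : 'I_#|G|) :=
  [ffun t : 'I_(size w).+1 => walk_end (enum_val i) (take t w)].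
exists (size w), F; split=> [i|].
  split=> [v|t t' tt'].
    have [|t t_le /= <-] := wP (enum_val i, v); first by rewrite mem_enum.
    by exists (Ordinal (t_le : t < (size w).+1)); rewrite ffunE.
  have ltt : t < size w by rewrite -ltnS -tt'.
  rewrite !ffunE tt' (take_nth 1%g) // /walk_end foldl_rcons.
  by have /forallP := shw _ (mem_nth 1%g ltt); apply.
apply/eqP; rewrite eqn_leq; apply/andP; split.
  (* Distance 1 is attained at time 0, when the tracks occupy all vertices, among them two adjacent
     ones. *)
  have [x [y [_ _ neq_xy]]] := card_gt1P G_gt1.
  have [z axz] : exists z, adj x z.
    case/connectP: (Gconn x y) => [[|z p] /=].
      by move=> _ eq_yx; rewrite eq_yx eqxx in neq_xy.
    by case/andP=> axz _ _; exists z.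
  have neq_zx : enum_rank z != enum_rank x.
    by apply: contraTneq axz => /enum_rank_inj ->; rewrite adj_irrefl.
  apply: leq_trans (fam_dist_leq F ord0 neq_zx) _.
  by rewrite !ffunE take0 /= !enum_rankK dist_adj.
(* The default [#|G|] of each nested minimum is positive; it remains to see that distinct starting
   vertices stay distinct, which holds because every step is a permutation. *)
do 3 (apply: leq_bigminn => [|? ?]; first exact: ltnW).
rewrite !ffunE dist_gt0 // (inj_eq (@walk_end_inj _)) (inj_eq enum_val_inj).
by rewrite eq_sym.
Qed.

(** The tracks must already start at distinct vertices. *)
Lemma direct_tour1_leq_card c : has_direct_tour1 G c -> c <= #|G|.
Proof.
case=> _ [l [F [_ F1]]].
have /leq_card : injective (F^~ ord0) by apply: fam_dist_inj; rewrite F1.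
by rewrite card_ord.
Qed.

(** * Paths of covered edges *)

Lemma path_edges_sub (e : rel G) x p (P : {set G} -> Prop) :
  (forall y z, e y z -> P [set y; z]) -> path e x p ->
  forall E, E \in path_edges x p -> P E.
Proof.
move=> eP; elim: p x => //= y p IHp x /andP[exy pth] E.
by rewrite in_cons => /predU1P[->|]; [apply: eP | apply: IHp].
Qed.

Lemma covered_path_connect x p : path adj x p ->
  (forall E, E \in path_edges x p -> covered_edge E) ->
  connect shift_rel x (last x p).
Proof.
elim: p x => [|y p IHp] x /=; first by rewrite connect0.
case/andP=> axy pth cov; apply: connect_trans (IHp y pth _).
  by apply/connect1/covered_shift_rel => //; apply: cov; rewrite mem_head.
by move=> E Ep; apply: cov; rewrite in_cons Ep orbT.
Qed.

End Topfull.

Theorem theorem3p21 (G : sgraph) (Gnontrivial : 1 < #|G|)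
    (Gconn : connected_graph G) :
  direct_topfull G <->
  (forall u v : G, exists2 p : seq G, is_upath u v p &
     forall E : {set G}, E \in path_edges u p -> covered_edge E).
Proof.
split=> [[_ [[_ [l [F [Ftrack F1]]]] _]] u v | cov].
  have /connectP[p pth ->] : connect (@shift_rel G) u v.
    by apply: tour_shift_connect Ftrack _; rewrite F1.
  (* The connecting walk may repeat vertices, whereas [is_upath] asks for a simple path. *)
  have [p' pth' Up' _] := shortenP pth.
  exists p'; last exact: path_edges_sub (@shift_rel_covered G) pth'.
  by rewrite /is_upath eqxx (sub_path (@sub_shift_adj G) pth').
split=> //; split; last exact: direct_tour1_leq_card.
apply: shift_connect_tour => // u v.
have [p /and3P[pth /eqP <- _]] := cov u v.
exact: covered_path_connect.
Qed.
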